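(* Let $b\ge 2$ and $N\ge 1$ be integers, let $\xi\neq 1$ be a complex number with $\xi^b=1$, and let $\beta_k^{(N-1)}$ be the weights defined in the context. Then for an arbitrary function $f:\mathbb{C}\to\mathbb{C}$ and all $x,y\in\mathbb{C}$, $$\sum_{n=0}^{b^{N}-1}\xi^{s_{b}(n)}f(x+ny)=(-1)^{N}\sum_{k=0}^{b^{N}-N-1}\beta_{k}^{(N-1)}\,\Delta_{k}^{N}f(x+ky).$$
   Context: For a nonnegative integer $n$, $s_b(n)$ denotes the sum of the digits of $n$ in base $b$. For an integer $M\ge 0$, the complex weights $\beta_k^{(M)}$ (depending on $b$ and $\xi$), $0\le k\le b^{M+1}-M-2$, are defined by the generating polynomial $$\sum_{k=0}^{b^{M+1}-M-2}\beta_{k}^{(M)}z^{k}=\prod_{l=0}^{M}\frac{1-z^{b^l}}{1-z}\left(\sum_{m=0}^{b-1}\Big(\sum_{j=0}^{m}\xi^{j}\Big)z^{m b^{l}}\right).$$ The operator $\Delta_k$ is the forward difference operator in the variable $k$: $\Delta_k f(x+ky)=f(x+(k+1)y)-f(x+ky)$, and $\Delta_k^N$ is its $N$-fold iterate. *)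

(* Defs.v *)
From mathcomp Require Import all_boot all_order all_algebra.
From mathcomp Require Import reals.
From mathcomp Require Import complex.
From mathcomp Require Import zify.

Set Implicit Arguments.
Unset Strict Implicit.
Unset Printing Implicit Defensive.

Import GRing.Theory.

Local Open Scope ring_scope.

(* For [b >= 2], all base-[b] digits of [n] of index [i > n] vanish, because
   [n < b ^ i]; hence the truncation of the sum. *)
Definition digit_sum (b n : nat) : nat :=
  (\sum_(0 <= i < n.+1) (n %/ b ^ i) %% b)%N.

Definition forward_diff (V : zmodType) (g : nat -> V) : nat -> V :=
  fun k => g k.+1 - g k.

(* [%/] is division in [{poly F}]; it is exact here, see [geometric_divE]. *)
Definition beta_poly (F : fieldType) (b : nat) (xi : F) (M : nat) : {poly F} :=
  \prod_(0 <= l < M.+1)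
    ((1 - 'X^(b ^ l)) %/ (1 - 'X)
     * \sum_(0 <= m < b) (\sum_(0 <= j < m.+1) xi ^+ j) *: 'X^(m * b ^ l)).

(* See [beta_polyE] for the range [0 <= k <= b ^ M.+1 - M - 2]. *)
Definition beta (F : fieldType) (b : nat) (xi : F) (M k : nat) : F :=
  (beta_poly b xi M)`_k.

Lemma geometric_divE (F : fieldType) (n : nat) :
  (1 - 'X^n) %/ (1 - 'X) = \sum_(0 <= i < n) 'X^i :> {poly F}.
Proof.
have X1 : ('X - 1 : {poly F}) != 0 by rewrite polyXsubC_eq0.
have E : 1 - 'X^n = (\sum_(0 <= i < n) 'X^i) * (1 - 'X) :> {poly F}.
  by rewrite -opprB subrX1 -mulNr opprB mulrC big_mkord.
by rewrite E mulpK // -opprB oppr_eq0.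
Qed.

Lemma beta_polyE (F : fieldType) (b : nat) (xi : F) (M : nat) :
  (2 <= b)%N -> xi != 1 -> xi ^+ b = 1 ->
  \sum_(0 <= k < (b ^ M.+1 - M - 2).+1) beta b xi M k *: 'X^k
  = beta_poly b xi M.
Proof.
move=> b2 xi1 xib.
have S0 : \sum_(0 <= j < b) xi ^+ j = 0.
  apply/eqP; have := subrX1 xi b.
  by rewrite xib subrr big_mkord => /esym/eqP; rewrite mulf_eq0 subr_eq0 (negPf xi1).
suff sz : (size (beta_poly b xi M) <= (b ^ M.+1 - M - 2).+1)%N.
  rewrite big_mkord -poly_def; apply/polyP => i; rewrite coef_poly /beta.
  by case: ltnP => // /(leq_trans sz) /(nth_default 0) ->.
suff h : (size (beta_poly b xi M) + M.+1 <= b ^ M.+1)%N.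
  have : (M.+1 < b ^ M.+1)%N by exact: ltn_expl.
  by move: h; lia.
have szG l : (size ((1 - 'X^(b ^ l)) %/ (1 - 'X) : {poly F})%R <= b ^ l)%N.
  rewrite geometric_divE big_mkord; apply: (leq_trans (size_sum _ _ _)).
  by apply/bigmax_leqP => i _; rewrite size_polyXn.
have szH l : (size (\sum_(0 <= m < b) (\sum_(0 <= j < m.+1) xi ^+ j)
                     *: 'X^(m * b ^ l) : {poly F})%R
     <= ((b - 2) * b ^ l).+1)%N.
  have -> : forall c, c = b -> \sum_(0 <= m < c) (\sum_(0 <= j < m.+1) xi ^+ j)
      *: 'X^(m * b ^ l) = \sum_(0 <= m < b.-1) (\sum_(0 <= j < m.+1) xi ^+ j)
      *: 'X^(m * b ^ l) :> {poly F}; last by [].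
    move=> c cb; have -> : c = b.-1.+1 by lia.
    rewrite big_nat_recr //=; have -> : b.-1.+1 = b by lia.
    by rewrite S0 scale0r addr0.
  rewrite big_mkord; apply: (leq_trans (size_sum _ _ _)).
  apply/bigmax_leqP => i _; apply: (leq_trans (size_scale_leq _ _)).
  rewrite size_polyXn ltnS leq_mul2r; apply/orP; right.
  by have := ltn_ord i; lia.
have step l (p q r : {poly F}) : (size p + l <= b ^ l)%N ->
    (size q <= b ^ l)%N -> (size r <= ((b - 2) * b ^ l).+1)%N ->
    (size (p * (q * r))%R + l.+1 <= b ^ l.+1)%N.
  move=> hp hq hr.
  have [->|pn0] := eqVneq p 0.
    by rewrite mul0r size_poly0 add0n ltnW // ltn_expl.
  have [->|qn0] := eqVneq q 0.
    by rewrite mul0r mulr0 size_poly0 add0n ltnW // ltn_expl.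
  have [->|rn0] := eqVneq r 0.
    by rewrite !mulr0 size_poly0 add0n ltnW // ltn_expl.
  have p0 : (0 < size p)%N by rewrite size_poly_gt0.
  have q0 : (0 < size q)%N by rewrite size_poly_gt0.
  have r0 : (0 < size r)%N by rewrite size_poly_gt0.
  rewrite !size_mul ?mulf_neq0 //.
  have : (b ^ l.+1 = b ^ l + b ^ l + (b - 2) * b ^ l)%N.
    by rewrite expnS -{1}(subnK b2) mulnDl mul2n -addnn addnC.
  move: hp hq hr p0 q0 r0; move: (size p) (size q) (size r) => sp sq sr.
  by move: (b ^ l.+1)%N (b ^ l)%N ((b - 2) * _)%N => u v w; lia.
rewrite /beta_poly; elim: M => [|M IH].
  rewrite big_nat1; have := step 0%N 1 _ _ _ (szG 0%N) (szH 0%N).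
  by rewrite mul1r size_poly1; apply.
by rewrite big_nat_recr //=; apply: step.
Qed.

(* Main.v *)
Require Import Defs.
From mathcomp Require Import all_boot all_order all_algebra.
From mathcomp Require Import reals.
From mathcomp Require Import complex.

Import GRing.Theory.

Local Open Scope ring_scope.

(** The identity is a generating-function identity read through a linear
    functional.  Fix a sequence [g] and let the functional [pairing g] send
    ['X^k] to [g k].  Multiplying a polynomial by ['X - 1] before pairing amounts
    to applying the forward difference to [g] ([pairing_XsubC1]), so, with
    [g k := f (x + k y)], the right-hand side of the theorem is the pairing of
    [g] with [(1 - 'X)^N * beta_poly b xi (N - 1)].

    The [N] factors [1 - 'X] cancel the [N] denominators [1 - 'X] of the
    generating polynomial of the weights, leaving in the factor of index [l],
    with [Y := 'X^(b ^ l)], the product of [1 - Y] and the polynomial whose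
    coefficients are the partial sums of the [xi ^ j].  Multiplication by
    [1 - Y] undoes partial summation, up to a boundary term which is the full
    sum of the [xi ^ j], [j < b]; it vanishes because [xi] is a nontrivial
    [b]-th root of unity.  So that factor is [\sum_(m < b) (xi ^ m) Y ^ m]
    ([mul_partial_sums]).

    Expanding the product of these factors chooses one digit [m] for each
    position [l]: every [n < b ^ N] arises exactly once, with coefficient
    [xi ^ digit_sum b n] ([prod_digits]).  Hence the polynomial above is the
    generating polynomial of the left-hand side. *)

(** In this form the number of digits is free, so that it can be taken to be
    the same for all [n < b ^ K], leading zeros included. *)
Lemma digit_sumE (b n K : nat) : (1 < b)%N -> (n < b ^ K)%N ->
  digit_sum b n = (\sum_(0 <= i < K) (n %/ b ^ i) %% b)%N.
Proof.
move=> b1 nK.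
have tail p q : (p <= q)%N -> (n < b ^ p)%N ->
    (\sum_(0 <= i < q) (n %/ b ^ i) %% b = \sum_(0 <= i < p) (n %/ b ^ i) %% b)%N.
  move=> pq np; rewrite (big_cat_nat (n := p)) //= [X in (_ + X)%N]big_nat.
  rewrite [X in (_ + X)%N]big1 ?addn0 // => i /andP[pi _]; rewrite divn_small ?mod0n //.
  by apply: leq_trans np _; rewrite leq_pexp2l // ltnW.
have nn : (n < b ^ n.+1)%N by apply: ltn_trans (ltn_expl n.+1 b1).
rewrite /digit_sum; case: (leqP n.+1 K) => [le|/ltnW le].
  by rewrite (tail _ _ le nn).
by rewrite (tail _ _ le nK).
Qed.

Lemma digit_sum_top (b K m a : nat) : (1 < b)%N -> (m < b)%N -> (a < b ^ K)%N ->
  digit_sum b (m * b ^ K + a) = (m + digit_sum b a)%N.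
Proof.
move=> b1 mb aK; have b0 : (0 < b)%N by exact: ltnW.
have nK : (m * b ^ K + a < b ^ K.+1)%N.
  by rewrite expnS (leq_trans _ (leq_mul mb (leqnn _))) // mulSn addnC ltn_add2r.
rewrite (digit_sumE _ _ _ b1 nK) (digit_sumE _ _ _ b1 aK) big_nat_recr //= addnC.
rewrite divnMDl ?expn_gt0 ?b0 // (divn_small aK) addn0 modn_small //.
congr (_ + _)%N; rewrite !big_nat; apply: eq_bigr => i /andP[_ iK].
(* below position [K], the summand [m * b ^ K] contributes a multiple of [b] *)
have -> : (m * b ^ K = m * b ^ (K - i.+1) * b * b ^ i)%N.
  by rewrite -!mulnA -expnS -expnD subnK.
by rewrite divnMDl ?expn_gt0 ?b0 // modnMDl.
Qed.

Lemma prod_digits (F : comNzRingType) (b : nat) (xi : F) (K : nat) : (1 < b)%N ->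
  \prod_(0 <= l < K) (\sum_(0 <= m < b) xi ^+ m *: 'X^(m * b ^ l))
  = \sum_(0 <= n < b ^ K) xi ^+ digit_sum b n *: 'X^n.
Proof.
move=> b1; elim: K => [|K IH].
  by rewrite big_nil expn0 big_nat1 (@digit_sumE b 0 0) // big_nil expr0 scale1r.
rewrite big_nat_recr //= IH mulrC mulr_suml expnS big_nat_mul.
rewrite !big_nat; apply: eq_bigr => m /andP[_ mb].
rewrite mulSn -{2}[(m * _)%N]add0n big_addn addnK mulr_sumr.
rewrite !big_nat; apply: eq_bigr => a /andP[_ aK].
rewrite addnC digit_sum_top // exprD exprD.
by rewrite -scalerAl -scalerAr scalerA.
Qed.

(** Summation by parts; the boundary term is the vanishing sum of all the
    powers of [xi]. *)
Lemma mul_partial_sums (F : fieldType) (b : nat) (xi : F) (Y : {poly F}) :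
  xi != 1 -> xi ^+ b = 1 ->
  (1 - Y) * (\sum_(0 <= m < b) (\sum_(0 <= j < m.+1) xi ^+ j) *: Y ^+ m)
  = \sum_(0 <= m < b) xi ^+ m *: Y ^+ m.
Proof.
move=> xi1 xib.
have S0 : \sum_(0 <= j < b) xi ^+ j = 0.
  apply/eqP; have /esym/eqP := subrX1 xi b.
  by rewrite xib subrr big_mkord mulf_eq0 subr_eq0 (negPf xi1).
suff parts n : (1 - Y) * (\sum_(0 <= m < n) (\sum_(0 <= j < m.+1) xi ^+ j) *: Y ^+ m)
    = \sum_(0 <= m < n) xi ^+ m *: Y ^+ m - (\sum_(0 <= j < n) xi ^+ j) *: Y ^+ n.
  by rewrite parts S0 scale0r subr0.
elim: n => [|n IH]; first by rewrite !big_nil mulr0 scale0r subr0.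
rewrite big_nat_recr //= mulrDr IH [in RHS]big_nat_recr //=.
rewrite mulrBl mul1r -scalerAr -exprS addrA; congr (_ - _).
by rewrite big_nat_recr //= scalerDl addrA subrK.
Qed.

Lemma beta_poly_digit_sum (F : fieldType) (b : nat) (xi : F) (M : nat) :
  (1 < b)%N -> xi != 1 -> xi ^+ b = 1 ->
  (1 - 'X) ^+ M.+1 * beta_poly b xi M
  = \sum_(0 <= n < b ^ M.+1) xi ^+ digit_sum b n *: 'X^n.
Proof.
move=> b1 xi1 xib; rewrite -prod_digits // /beta_poly.
have -> : (1 - 'X) ^+ M.+1 = \prod_(0 <= l < M.+1) (1 - 'X : {poly F}).
  by rewrite prodr_const_nat subn0.
rewrite -big_split /=; apply: eq_bigr => l _.
rewrite geometric_divE mulrA.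
have -> : (1 - 'X) * (\sum_(0 <= i < b ^ l) 'X^i) = 1 - 'X^(b ^ l) :> {poly F}.
  by rewrite big_mkord -opprB mulNr -subrX1 opprB.
have Xl m : 'X^(m * b ^ l) = 'X^(b ^ l) ^+ m :> {poly F} by rewrite mulnC exprM.
under eq_bigr do rewrite Xl; under [RHS]eq_bigr do rewrite Xl.
exact: mul_partial_sums.
Qed.

Definition pairing {F : nzRingType} (g : nat -> F) (p : {poly F}) : F :=
  \sum_(i < size p) p`_i * g i.

Lemma pairing_widen (F : nzRingType) (g : nat -> F) (p : {poly F}) (n : nat) :
  (size p <= n)%N -> pairing g p = \sum_(i < n) p`_i * g i.
Proof.
move=> pn; rewrite /pairing (big_ord_widen n (fun i => p`_i * g i) pn).
rewrite big_mkcond; apply: eq_bigr => i _.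
by case: ltnP => // /(nth_default 0) ->; rewrite mul0r.
Qed.

Lemma pairing_sum (F : nzRingType) (g : nat -> F) (c : nat -> F) (n : nat) :
  pairing g (\sum_(0 <= k < n) c k *: 'X^k) = \sum_(0 <= k < n) c k * g k.
Proof.
rewrite !big_mkord -poly_def (pairing_widen _ _ _ _ (size_poly _ _)).
by apply: eq_bigr => i _; rewrite coef_poly ltn_ord.
Qed.

(** Shifting a sequence is adjoint to multiplying polynomials by ['X]. *)
Lemma pairing_XsubC1 (F : nzRingType) (g : nat -> F) (p : {poly F}) :
  pairing (forward_diff g) p = pairing g (('X - 1) * p).
Proof.
have sz : (size (('X - 1) * p)%R <= (size p).+1)%N.
  by apply: leq_trans (size_polyMleq _ _) _; rewrite size_XsubC.
rewrite (pairing_widen _ _ _ _ sz) mulrBl mul1r.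
under [RHS]eq_bigr do rewrite coefB coefXM mulrBl.
rewrite sumrB [X in X - _]big_ord_recl /= mul0r add0r.
rewrite -(pairing_widen _ g p _ (leqnSn _)) /pairing -sumrB.
by apply: eq_bigr => i _; rewrite mulrBr.
Qed.

Lemma pairing_iter_diff (F : comNzRingType) (g : nat -> F) (N : nat) (p : {poly F}) :
  pairing (iter N (@forward_diff F) g) p = pairing g (('X - 1) ^+ N * p).
Proof.
elim: N p => [|N IH] p; first by rewrite mul1r.
by rewrite iterS pairing_XsubC1 IH mulrA -exprSr.
Qed.

Lemma pairingZ (F : nzRingType) (g : nat -> F) (c : F) (p : {poly F}) :
  pairing g (c *: p) = c * pairing g p.
Proof.
rewrite (pairing_widen _ _ _ _ (size_scale_leq c p)) /pairing mulr_sumr.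
by apply: eq_bigr => i _; rewrite coefZ mulrA.
Qed.

Theorem theorem4 (R : realType) (b N : nat) (xi : R[i])
    (hb : (2 <= b)%N) (hN : (1 <= N)%N) (hxi1 : xi != 1) (hxib : xi ^+ b = 1)
    (f : R[i] -> R[i]) (x y : R[i]) :
  \sum_(0 <= n < b ^ N) xi ^+ digit_sum b n * f (x + n%:R * y) =
  (-1) ^+ N *
    \sum_(0 <= k < (b ^ N - N - 1).+1)
      beta b xi (N - 1) k *
      iter N (@forward_diff _) (fun j : nat => f (x + j%:R * y)) k.
Proof.
case: N hN => // M _; rewrite subn1 subSS subn0.
have -> : ((b ^ M.+1 - M.+1).-1 = b ^ M.+1 - M - 2)%N.
  by rewrite -subn1 -!subnDA addn1 addn2.
rewrite -!pairing_sum (pairing_sum _ (fun j : nat => f (x + j%:R * y))).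
rewrite beta_polyE // pairing_iter_diff -pairingZ scalerAl.
have -> : (-1) ^+ M.+1 *: ('X - 1) ^+ M.+1 = (1 - 'X) ^+ M.+1 :> {poly R[i]}.
  by rewrite -exprZn scaleN1r opprB.
by rewrite beta_poly_digit_sum // pairing_sum.
Qed.
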